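(* Let $a$, $b$, $c$ be square-free, pairwise relatively prime positive integers. If $a$, $b$ and $c$ are all odd, then any integer congruent to $-abc$ modulo $8(abc)^2$ is not represented by $ax^2+by^2+cz^2$ over the rational numbers. If one of $a$, $b$, $c$ is even, then any integer congruent to $-abc$ modulo $(2abc)^2$ is not represented by $ax^2+by^2+cz^2$ over the rational numbers.
   Context: A number $N$ is represented by $ax^2+by^2+cz^2$ over the rational numbers if there exist $x,y,z\in\mathbb{Q}$ with $ax^2+by^2+cz^2=N$. *)

(* Defs.v *)
From mathcomp Require Import all_boot all_order all_algebra.

Set Implicit Arguments.
Unset Strict Implicit.
Unset Printing Implicit Defensive.

Local Open Scope ring_scope.

Definition squarefree (n : nat) : Prop :=
  forall d : nat, (d ^ 2 %| n)%N -> d = 1%N.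

Definition represented_over_rat (a b c : nat) (N : int) : Prop :=
  exists x y z : rat,
    a%:R * x ^+ 2 + b%:R * y ^+ 2 + c%:R * z ^+ 2 = N%:~R.

(* Main.v *)
Require Import Defs.
From mathcomp Require Import all_boot all_order all_algebra.
From mathcomp Require Import finfield zify ring.

(* A representation of [N] gives a primitive integral zero of
   [a x^2 + b y^2 + c z^2 + a b c w^2] modulo 16 (8 if [abc] is odd) and modulo
   [(abc)^2].  If [-bc] is a non-residue modulo an odd prime [p | a], then [p]
   divides all four variables, a contradiction, and similarly for [b] and [c].
   Quadratic reciprocity expresses the product of the Jacobi symbols [(-bc/a)],
   [(-ac/b)], [(-ab/c)] (over the odd parts) by the residues of [a], [b], [c]
   modulo 8: either it is [-1] and such a [p] exists, or these residues force
   all four variables to be even. *)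

Set Implicit Arguments.
Unset Strict Implicit.
Unset Printing Implicit Defensive.

Import GRing.Theory Num.Theory.

Local Open Scope ring_scope.

(* By Euler's criterion this is non-residuosity of [z] modulo an odd prime [p]
   not dividing [z]; it is [false] when [p] divides [z]. *)
Definition qnr (p : nat) (z : int) : bool := (z%:~R : 'F_p) ^+ p./2 == -1.

Lemma odd_sum_nat (F : nat -> nat) s :
  odd (\sum_(i <- s) F i)%N = \big[addb/false]_(i <- s) odd (F i).
Proof. by apply: (big_morph odd oddD). Qed.

(** * Euler's criterion modulo an odd prime *)

Section OddPrime.
Variable p : nat.
Hypotheses (p_pr : prime p) (p_odd : odd p).
Let pE : p = (2 * p./2).+1.
Proof. by move: p_odd; lia. Qed.

Lemma Fp_nat_eq0 (n : nat) : (n%:R == 0 :> 'F_p) = (p %| n)%N.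
Proof. by rewrite (dvdn_pcharf (pchar_Fp p_pr)). Qed.

Lemma Fp_int_eq0 (z : int) : (z%:~R == 0 :> 'F_p) = (p %| `|z|)%N.
Proof.
case: z => n; first exact: Fp_nat_eq0.
by rewrite NegzE mulrNz oppr_eq0; exact: (Fp_nat_eq0 n.+1).
Qed.

Lemma Fp_1_neq_N1 : (1 == -1 :> 'F_p) = false.
Proof.
rewrite -subr_eq0 opprK (Fp_nat_eq0 2); apply/negP => /dvdn_leq.
by have := prime_gt1 p_pr; lia.
Qed.

Lemma Fp_expf_half2 (x : 'F_p) : x != 0 -> (x ^+ p./2) ^+ 2 = 1.
Proof.
move=> x0; apply: (mulIf x0); rewrite mul1r -exprM mulnC -exprSr.
have -> : (2 * p./2).+1 = #|'F_p| by rewrite card_Fp // -pE.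
by rewrite expf_card.
Qed.

Lemma qnrE z : (z%:~R != 0 :> 'F_p) -> (z%:~R : 'F_p) ^+ p./2 = (-1) ^+ qnr p z.
Proof.
move=> /Fp_expf_half2/eqP; rewrite sqrf_eq1 /qnr => /orP[] /eqP->.
  by rewrite Fp_1_neq_N1.
by rewrite eqxx.
Qed.

(** As [p] is odd, 1 and -1 differ in ['F_p], so a sign can be read off from its image there. *)
Lemma qnr_sign (b : bool) z : (z%:~R : 'F_p) ^+ p./2 = (-1) ^+ b -> qnr p z = b.
Proof. by rewrite /qnr => ->; case: b; rewrite ?expr1 ?expr0 ?eqxx ?Fp_1_neq_N1. Qed.

Lemma qnrM (x y : int) : ~~ (p %| `|x|)%N -> ~~ (p %| `|y|)%N ->
  qnr p (x * y) = qnr p x (+) qnr p y.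
Proof.
rewrite -!Fp_int_eq0 => x0 y0; apply: qnr_sign.
by rewrite intrM exprMn !qnrE // signr_addb.
Qed.

Lemma qnr1 : qnr p 1 = false.
Proof. by apply: qnr_sign; rewrite expr1n. Qed.

Lemma qnrN1 : qnr p (-1) = odd p./2.
Proof. by apply: qnr_sign; rewrite mulrNz signr_odd. Qed.

(** If [p] did not divide [y], then [- n] would be the square of [x / y] in ['F_p], and its power
    [p./2] would be 0 or 1 instead of -1. Once [p] divides [y], it divides [x ^ 2]. *)
Lemma qnr_sqr_add (n : nat) (x y : nat) :
  qnr p (- n%:Z) -> (p %| x ^ 2 + n * y ^ 2)%N -> (p %| x)%N && (p %| y)%N.
Proof.
rewrite /qnr mulrNz => /eqP nr; rewrite -!Fp_nat_eq0 natrD natrM !natrX.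
rewrite addr_eq0 -mulNr => /eqP xy.
have [y0|y0] := eqVneq (y%:R : 'F_p) 0.
  by move/eqP: xy; rewrite y0 expr0n mulr0 sqrf_eq0 => ->.
move: nr; have -> : - (n%:Z%:~R : 'F_p) = (x%:R / y%:R) ^+ 2.
  by rewrite expr_div_n xy mulfK ?sqrf_eq0.
have [->|x0] := eqVneq (x%:R : 'F_p) 0.
  rewrite mul0r expr0n /= expr0n; have -> : (p./2 == 0)%N = false.
    by have := prime_gt1 p_pr; lia.
  by move/eqP; rewrite eq_sym oppr_eq0 oner_eq0.
rewrite exprAC Fp_expf_half2 ?mulf_neq0 ?invr_eq0 // => /eqP.
by rewrite Fp_1_neq_N1.
Qed.

(** * Gauss's lemma and quadratic reciprocity by Eisenstein's lattice count *)

Section Gauss.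
Variable q : nat.
Hypothesis pq : ~~ (p %| q)%N.

Let r i := (q * i %% p)%N.
(* Up to sign, [f i] is [q * i] modulo [p]; [f] permutes [1 .. (p - 1) / 2]. *)
Let f i := (if r i <= p./2 then r i else p - r i)%N.

Let r_lt i : (r i < p)%N. Proof. by rewrite ltn_mod prime_gt0. Qed.

Let r_gt0 i : (0 < i <= p./2 -> 0 < r i)%N.
Proof.
move=> /andP[i0 ip]; rewrite lt0n -[_ == 0%N]/(p %| q * i)%N Euclid_dvdM // negb_or pq.
by apply/negP => /dvdn_leq; lia.
Qed.

Let f_range i : (0 < i <= p./2 -> 0 < f i <= p./2)%N.
Proof.
move=> /r_gt0 r0; have := r_lt i; rewrite /f.
by move: (r i) r0 => k; case: (leqP k p./2); lia.
Qed.

(** If [f i = f j], then [q * i] is plus or minus [q * j] modulo [p], so [p] divides [i - j] or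
    [i + j]. As [i + j < p], this forces [i = j]. An injection of a finite set into itself is a
    permutation. *)
Let f_perm : perm_eq (map f (index_iota 1 p./2.+1)) (index_iota 1 p./2.+1).
Proof.
have fE i : (f i = r i \/ f i + r i = p)%N.
  by rewrite /f; case: (leqP (r i) p./2) => _; [left | right; rewrite subnK // ltnW].
have subr i j : r i = r j -> (i <= j)%N -> (p %| j - i)%N.
  move=> /eqP eqr ij; move: eqr; rewrite eq_sym eqn_mod_dvd ?leq_mul2l ?ij ?orbT //.
  by rewrite -mulnBr Euclid_dvdM // (negPf pq).
have addr i j : (r i + r j = p)%N -> (p %| i + j)%N.
  move=> eqr; have : (p %| q * (i + j))%N.
    by rewrite mulnDr /dvdn -modnDm -/(r i) -/(r j) eqr modnn.
  by rewrite Euclid_dvdM // (negPf pq).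
have uf : uniq (map f (index_iota 1 p./2.+1)).
  rewrite map_inj_in_uniq ?iota_uniq // => i j; rewrite !mem_index_iota => i_r j_r fij.
  have [eqr|eqr] : (r i = r j \/ r i + r j = p)%N.
    by case: (fE i); case: (fE j); have := r_lt i; have := r_lt j; lia.
  - case: (leqP i j) => [ij|/ltnW ij].
    + by have := subr _ _ eqr ij; case: (posnP (j - i)) => [|? /dvdn_leq]; lia.
    + by have := subr _ _ (esym eqr) ij; case: (posnP (i - j)) => [|? /dvdn_leq]; lia.
  - by have /dvdn_leq := addr _ _ eqr; lia.
apply: uniq_perm; rewrite ?iota_uniq //.
have sf : {subset map f (index_iota 1 p./2.+1) <= index_iota 1 p./2.+1}.
  move=> x /mapP[i]; rewrite mem_index_iota => i_r ->.
  by rewrite mem_index_iota; have := f_range (i := i); lia.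
by have [] := uniq_min_size uf sf; rewrite ?size_map.
Qed.

(** Gauss's lemma: in the product of all [q * i], each factor is [f i] up to a sign, which is -1
    when [r i] exceeds [p./2]. By [f_perm] the product of the [f i] is that of the [i], which
    cancels. *)
Lemma qnr_gauss :
  qnr p q%:Z = odd (\sum_(1 <= i < p./2.+1) (p./2 < (q * i) %% p))%N.
Proof.
apply: qnr_sign; rewrite signr_odd.
have P0 : \prod_(1 <= i < p./2.+1) (i%:R : 'F_p) != 0.
  rewrite prodf_seq_neq0; apply/allP => i; rewrite mem_index_iota /= => i_r.
  by rewrite Fp_nat_eq0; apply/negP => /dvdn_leq; lia.
apply: (mulIf P0).
have -> : (q%:Z%:~R : 'F_p) ^+ p./2 = \prod_(1 <= i < p./2.+1) (q%:R : 'F_p).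
  by rewrite prodr_const_nat subn1.
rewrite -big_split -[X in _ = _ * X](perm_big _ f_perm) big_map /= expr_sum -big_split /=.
apply: eq_big_seq => i _; rewrite -/(r i).
have -> : (q%:R * i%:R : 'F_p) = (r i)%:R by rewrite -natrM -Fp_nat_mod.
rewrite /f; case: (leqP (r i) p./2) => _; first by rewrite expr0 mul1r.
by rewrite expr1 natrB ?(ltnW (r_lt i)) // pchar_Fp_0 // sub0r mulrN mulN1r opprK.
Qed.

(** Two parity computations are compared. Division with remainder gives [key], the sum of the
    [q * i]. Since [p] is odd, [f i] and [r i] differ in parity exactly when [r i] exceeds [p./2],
    which yields [sf] by Gauss's lemma. *)
Lemma qnr_eisenstein :
  qnr p q%:Z = odd (\sum_(1 <= i < p./2.+1) (q * i) %/ p)%N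
                (+) (~~ odd q && odd (\sum_(1 <= i < p./2.+1) i)%N).
Proof.
have key : (\sum_(1 <= i < p./2.+1) (q * i) = p * (\sum_(1 <= i < p./2.+1) (q * i) %/ p)
   + \sum_(1 <= i < p./2.+1) r i)%N.
  rewrite big_distrr -big_split /=; apply: eq_bigr => i _.
  by rewrite mulnC [RHS]addnC addnC mulnC [(p * _)%N]mulnC -divn_eq.
have sf : (odd (\sum_(1 <= i < p./2.+1) i) =
   odd (\sum_(1 <= i < p./2.+1) r i) (+) qnr p q%:Z)%N.
  rewrite -(perm_big _ f_perm) big_map qnr_gauss -oddD -big_split /= !odd_sum_nat.
  apply: eq_bigr => i _; rewrite -/(r i) /f oddD; case: (leqP (r i) p./2); rewrite ?addbF //.
  by rewrite oddB ?(ltnW (r_lt i)) // p_odd addbC.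
move/(congr1 odd): key; rewrite -big_distrr /= oddD !oddM p_odd /= sf.
by do 3!case: (odd _) => //=; case: (qnr _ _).
Qed.

End Gauss.

(** All quotients [(2 * i) %/ p] vanish, leaving the parity of 1 + ... + [p./2]. It depends on
    [p./2] modulo 4 only, that is, on [p] modulo 8. *)
Lemma qnr2 : qnr p 2%:Z = (p %% 8 == 3)%N || (p %% 8 == 5)%N.
Proof.
rewrite qnr_eisenstein; last by apply/negP => /dvdn_leq; have := prime_gt1 p_pr; lia.
rewrite big_nat big1 /=; last by move=> i i_r; rewrite divn_small; lia.
have : (2 * (\sum_(1 <= i < p./2.+1) i) = p./2 * p./2.+1)%N.
  elim: p./2 => [|k IH]; first by rewrite big_geq.
  by rewrite big_nat_recr //= mulnDr IH; lia.
move: (\sum_(_ <= _ < _) _)%N => S SE; rewrite [in RHS]pE.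
have := divn_eq p./2 4; have : (p./2 %% 4 < 4)%N by rewrite ltn_mod.
move: (p./2 %/ 4)%N (p./2 %% 4)%N => k j j4 kj; rewrite kj in SE *.
by case: j SE j4 {kj} => [|[|[|[|]]]] //= SE _; nia.
Qed.

End OddPrime.

(** The quotient counts the [j] from 1 up to itself. The bound on [i] keeps it at most [v./2], so
    the range of summation misses none. *)
Lemma divn_count u v i : odd u -> odd v -> (1 <= i < u./2.+1)%N ->
  ((v * i) %/ u = \sum_(1 <= j < v./2.+1) (u * j <= v * i))%N.
Proof.
move=> ou ov i_r.
have u0 : (0 < u)%N by lia.
have K_le : ((v * i) %/ u <= v./2)%N by rewrite -ltnS ltn_divLR //; nia.
rewrite (eq_bigr (fun j => (j <= (v * i) %/ u)%N : nat)); last first.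
  by move=> j _; rewrite leq_divRL // mulnC.
move: (_ %/ _)%N K_le => K K_le.
rewrite (big_cat_nat _ (n := K.+1)) //= [X in (_ + X)%N]big_nat [X in (_ + X)%N]big1 ?addn0.
  rewrite big_nat (eq_bigr (fun=> 1%N)); last by move=> j; lia.
  by rewrite -big_nat sum_nat_const_nat; lia.
by move=> j; lia.
Qed.

(** By [divn_count], the two Eisenstein sums count the points ([i], [j]) of the [p./2] by [q./2]
    rectangle on either side of the line [p * j = q * i]. No point lies on that line, so together
    they count the whole rectangle. *)
Lemma qnr_reciprocity p q : prime p -> prime q -> odd p -> odd q -> p != q ->
  qnr p q%:Z (+) qnr q p%:Z = odd p./2 && odd q./2.
Proof.
move=> p_pr q_pr p_odd q_odd pq.
have npq : ~~ (p %| q)%N by rewrite dvdn_prime2.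
have nqp : ~~ (q %| p)%N by rewrite dvdn_prime2 // eq_sym.
rewrite !qnr_eisenstein // p_odd q_odd !addbF -oddD -oddM; congr odd.
rewrite (eq_big_nat _ _ (fun i => @divn_count p q i p_odd q_odd)).
rewrite (eq_big_nat _ _ (fun i => @divn_count q p i q_odd p_odd)).
rewrite [X in (_ + X)%N]exchange_big /=.
rewrite -big_split /= -[RHS]/(_ * _)%N.
transitivity (\sum_(1 <= i < p./2.+1) \sum_(1 <= j < q./2.+1) 1)%N; last first.
  by rewrite !sum_nat_const_nat !subn1 muln1.
apply: eq_big_nat => i i_r; rewrite -big_split /=; apply: eq_big_nat => j j_r.
have : (p * j != q * i)%N.
  apply/negP => /eqP pjqi; have : (p %| q * i)%N by rewrite -pjqi dvdn_mulr.
  by rewrite Euclid_dvdM // (negPf npq) => /dvdn_leq; lia.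
by case: (ltngtP (p * j) (q * i)).
Qed.

(** * Jacobi symbols of squarefree numbers *)

Lemma squarefree_prod_primes n : (0 < n)%N -> squarefree n ->
  n = (\prod_(p <- primes n) p)%N.
Proof.
move=> n0 sqf; rewrite [LHS]prod_prime_decomp // prime_decompE big_map /=.
apply: eq_big_seq => p; rewrite mem_primes => /and3P[p_pr _ pn].
have l0 : (0 < logn p n)%N by rewrite logn_gt0 mem_primes p_pr n0.
suff -> : logn p n = 1%N by [].
apply/eqP; rewrite eqn_leq l0 andbT leqNgt; apply/negP => l2.
have := sqf p; rewrite pfactor_dvdn // => /(_ l2) p1.
by move: p_pr; rewrite p1.
Qed.

(** Reduces a multiplicative sign to its values at primes. The predicate [P], such as oddness or
    being prime to a given prime, delimits where [f] is additive. *)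
Lemma additive_primes (P : pred nat) (f : nat -> bool) n :
    f 1%N = false -> (forall m k, P (m * k)%N = P m && P k) ->
    (forall m k, P m -> P k -> f (m * k)%N = f m (+) f k) ->
    (0 < n)%N -> squarefree n -> P n ->
  f n = \big[addb/false]_(p <- primes n) f p.
Proof.
move=> f1 PM fM n0 sqf; rewrite {1 2}(squarefree_prod_primes n0 sqf).
elim: (primes n) => [|p s IH]; first by rewrite !big_nil.
by rewrite !big_cons PM => /andP[Pp Ps]; rewrite fM // IH.
Qed.

(* The Jacobi symbol, written additively, for squarefree [n]: the exponents of
   the primes of [n] are ignored. *)
Definition jac (n : nat) (z : int) : bool :=
  \big[addb/false]_(p <- primes n) qnr p z.

Lemma jac_exists n z : jac n z -> exists2 p, p \in primes n & qnr p z.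
Proof.
move=> j; apply/hasP; apply: contraLR j => /hasPn h; rewrite /jac big1_seq //.
by move=> p /= /h /negPf.
Qed.

(* For odd [n], [(-1)^(eps n)] and [(-1)^(tau n)] are the Jacobi symbols [(-1/n)]
   and [(2/n)]. *)
Definition eps (n : nat) : bool := odd n./2.
Definition tau (n : nat) : bool := (n %% 8 == 3)%N || (n %% 8 == 5)%N.

Lemma epsM m n : odd m -> odd n -> eps (m * n) = eps m (+) eps n.
Proof.
rewrite /eps => om on; have -> : m = (2 * m./2 + 1)%N by lia.
have -> : n = (2 * n./2 + 1)%N by lia.
move: m./2 n./2 => k l; rewrite -oddD.
have -> : ((2 * k + 1) * (2 * l + 1) = 2 * (k + l + 2 * (k * l)) + 1)%N by ring.
move: (k * l)%N => t; lia.
Qed.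

Lemma tauM m n : odd m -> odd n -> tau (m * n) = tau m (+) tau n.
Proof.
have odd8 k : odd k = odd (k %% 8) by lia.
rewrite /tau -modnMm [odd m]odd8 [odd n]odd8.
have := ltn_pmod m (isT : 0 < 8)%N; have := ltn_pmod n (isT : 0 < 8)%N.
move: (m %% 8)%N (n %% 8)%N => i j.
by case: i => [|[|[|[|[|[|[|[|i]]]]]]]] //; case: j => [|[|[|[|[|[|[|[|j]]]]]]]].
Qed.

Section Jacobi.
Variable n : nat.
Hypotheses (n_gt0 : (0 < n)%N) (n_sqf : squarefree n) (n_odd : odd n).

Lemma odd_primes p : p \in primes n -> prime p /\ odd p.
Proof.
rewrite mem_primes => /and3P[p_pr _ pn]; split=> //.
exact: dvdn_odd pn n_odd.
Qed.

Lemma jacN1 : jac n (-1) = eps n.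
Proof.
rewrite (additive_primes (f := eps) _ oddM epsM) //.
by apply: eq_big_seq => p /odd_primes[p_pr p_odd]; apply: qnrN1.
Qed.

Lemma jac2 : jac n 2%:Z = tau n.
Proof.
rewrite (additive_primes (f := tau) _ oddM tauM) //.
by apply: eq_big_seq => p /odd_primes[p_pr p_odd]; apply: qnr2.
Qed.

Lemma jacM x y : coprime n `|x| -> coprime n `|y| ->
  jac n (x * y) = jac n x (+) jac n y.
Proof.
have cop z p : p \in primes n -> coprime n z -> ~~ (p %| z)%N.
  rewrite mem_primes => /and3P[p_pr _ pn] co.
  by rewrite -prime_coprime //; apply: coprime_dvdl co.
move=> cx cy; rewrite /jac -big_split; apply: eq_big_seq => p pn.
by have [p_pr p_odd] := odd_primes pn; rewrite qnrM // (cop _ _ pn).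
Qed.

End Jacobi.

Lemma jac_primes a b : (0 < b)%N -> squarefree b -> odd a -> coprime a b ->
  jac a b%:Z = \big[addb/false]_(p <- primes a) \big[addb/false]_(q <- primes b) qnr p q%:Z.
Proof.
move=> b0 sb oa co; apply: eq_big_seq => p pa; have [p_pr p_odd] := odd_primes oa pa.
apply: (additive_primes (P := fun q => ~~ (p %| q)%N) (f := fun q => qnr p q%:Z)) => //.
- exact: qnr1.
- by move=> m k; rewrite Euclid_dvdM // negb_or.
- by move=> m k pm pk; rewrite PoszM qnrM.
- rewrite -prime_coprime //; apply: coprime_dvdl co.
  by move: pa; rewrite mem_primes => /and3P[].
Qed.

(** Prime reciprocity is summed over all pairs of a prime of [a] and a prime of [b], distinct by
    coprimality. The right side factors since [eps] is additive over primes and [&&] distributes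
    over [(+)]. *)
Lemma jac_reciprocity a b : (0 < a)%N -> (0 < b)%N ->
  squarefree a -> squarefree b -> odd a -> odd b -> coprime a b ->
  jac a b%:Z (+) jac b a%:Z = eps a && eps b.
Proof.
move=> a0 b0 sa sb oa ob co.
rewrite !jac_primes // 1?coprime_sym // [X in _ (+) X]exchange_big -big_split /=.
rewrite (additive_primes (f := eps) (n := a) _ oddM epsM) //.
rewrite (additive_primes (f := eps) (n := b) _ oddM epsM) //.
rewrite big_distrlr /=; apply: eq_big_seq => p pa; rewrite -big_split /=.
apply: eq_big_seq => q qb.
have [p_pr p_odd] := odd_primes oa pa; have [q_pr q_odd] := odd_primes ob qb.
apply: qnr_reciprocity => //; apply/negP => /eqP pq.
move: pa qb; rewrite -pq !mem_primes => /and3P[_ _ pa] /and3P[_ _ pb].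
have : (p %| gcdn a b)%N by rewrite dvdn_gcd pa.
by rewrite (eqP co) dvdn1 => /eqP p1; rewrite p1 in p_pr.
Qed.

(** * Primitive zeros and the obstruction at an odd prime *)

(* The variables [s], [t], [u], [w] stand for squares. *)
Definition quad (a b c s t u w : nat) : nat := (a * s + b * t + c * u + a * b * c * w)%N.

Definition primitive (x y z w : nat) : Prop :=
  forall p, prime p -> ~~ [&& p %| x, p %| y, p %| z & p %| w]%N.

(** Clearing denominators gives [a x^2 + b y^2 + c z^2 = N w^2], and dividing by the common gcd
    makes the solution primitive. Then [quad] takes the value [(N + abc) w^2], a multiple of [M]. *)
Lemma represented_primitive (a b c M : nat) (N : int) :
  (N = - (a * b * c)%N%:Z %[mod M])%Z -> represented_over_rat a b c N ->
  exists x y z w : nat,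
    primitive x y z w /\ (M %| quad a b c (x ^ 2) (y ^ 2) (z ^ 2) (w ^ 2))%N.
Proof.
move=> /eqP; rewrite eqz_mod_dvd opprK => MN [x [y [z E]]].
pose d := denq x * denq y * denq z.
have {E} E : a%:Z * (numq x * denq y * denq z) ^+ 2 + b%:Z * (numq y * denq x * denq z) ^+ 2
    + c%:Z * (numq z * denq x * denq y) ^+ 2 = N * d ^+ 2.
  apply: (@intr_inj rat); move: E; rewrite /d.
  rewrite -[in a%:R * _](divq_num_den x) -[in b%:R * _](divq_num_den y).
  rewrite -[in c%:R * _](divq_num_den z).
  have := denq_neq0 x; have := denq_neq0 y; have := denq_neq0 z.
  rewrite -!(intr_eq0 rat) => z0 y0 x0 E.
  rewrite !(intrD, intrM, rmorphXn) /= -E -!pmulrn; field.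
  by rewrite z0 y0.
have d0 : (0 < `|d|)%N by rewrite absz_gt0 !mulf_neq0 ?denq_neq0.
have {E d d0} [X [Y [Z [D [D0 E]]]]] : exists X Y Z D : nat, (0 < D)%N /\
    a%:Z * X%:Z ^+ 2 + b%:Z * Y%:Z ^+ 2 + c%:Z * Z%:Z ^+ 2 = N * D%:Z ^+ 2.
  (* Only squares occur, so absolute values can be taken. *)
  exists (absz (numq x * denq y * denq z)), (absz (numq y * denq x * denq z)).
  exists (absz (numq z * denq x * denq y)), (absz d); split=> //.
  by rewrite !abszE !real_normK ?num_real.
pose g := gcdn (gcdn X Y) (gcdn Z D).
have g0 : (0 < g)%N by rewrite !gcdn_gt0 D0 !orbT.
have gX : (g %| X)%N by rewrite (dvdn_trans (dvdn_gcdl _ _)) // dvdn_gcdl.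
have gY : (g %| Y)%N by rewrite (dvdn_trans (dvdn_gcdl _ _)) // dvdn_gcdr.
have gZ : (g %| Z)%N by rewrite (dvdn_trans (dvdn_gcdr _ _)) // dvdn_gcdl.
have gD : (g %| D)%N by rewrite (dvdn_trans (dvdn_gcdr _ _)) // dvdn_gcdr.
exists (X %/ g)%N, (Y %/ g)%N, (Z %/ g)%N, (D %/ g)%N; split.
  move=> p p_pr; apply/negP => /and4P[pX pY pZ pD].
  have : (p * g %| g)%N by rewrite !dvdn_gcd -!dvdn_divRL ?pX ?pY ?pZ.
  by rewrite -{2}[g]mul1n dvdn_pmul2r // dvdn1 => /eqP p1; rewrite p1 in p_pr.
move: E; rewrite -{1}(divnK gX) -{1}(divnK gY) -{1}(divnK gZ) -{1}(divnK gD).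
move: (X %/ g)%N (Y %/ g)%N (Z %/ g)%N (D %/ g)%N => {gX gY gZ gD D0} x' y' z' w E.
have {}E : a%:Z * x'%:Z ^+ 2 + b%:Z * y'%:Z ^+ 2 + c%:Z * z'%:Z ^+ 2 = N * w%:Z ^+ 2.
  have gg : g%:Z ^+ 2 != 0 by rewrite sqrf_eq0; lia.
  by apply: (mulIf gg); move: E; rewrite !PoszM => E; rewrite -mulrA -exprMn -E; ring.
have : (M%:Z %| (N + (a * b * c)%N%:Z) * w%:Z ^+ 2)%Z by apply: dvdz_mulr.
suff -> : (N + (a * b * c)%N%:Z) * w%:Z ^+ 2 =
    (quad a b c (x' ^ 2) (y' ^ 2) (z' ^ 2) (w ^ 2))%:Z by [].
by rewrite mulrDl -E /quad -!mulnn !PoszD !PoszM; ring.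
Qed.

(** Modulo [p] only [b y^2 + c z^2] remains; [b] times it is [(b y)^2 + b c z^2], so [p] divides [y]
    and [z]. Modulo [p ^ 2] there remains [a (x^2 + b c w^2)], and [p] divides [a] only once, so [p]
    divides [x] and [w] as well. *)
Lemma local_obstruction p a b c x y z w :
    prime p -> odd p -> squarefree a -> (p %| a)%N ->
    coprime a b -> coprime a c -> qnr p (- (b * c)%N%:Z) -> 
    primitive x y z w -> 
  ~~ (p ^ 2 %| quad a b c (x ^ 2) (y ^ 2) (z ^ 2) (w ^ 2))%N.
Proof.
move=> p_pr p_odd sa pa ab ac nr prim; apply/negP => dv.
have co n : coprime a n -> ~~ (p %| n)%N.
  by move=> an; rewrite -prime_coprime // (coprime_dvdl pa).
have p0 := prime_gt0 p_pr.
have [pz py] : (p %| z)%N /\ (p %| y)%N.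
  have : (p %| (b * y) ^ 2 + b * c * z ^ 2)%N.
    have -> : ((b * y) ^ 2 + b * c * z ^ 2 = b * (b * y ^ 2 + c * z ^ 2))%N by ring.
    apply: dvdn_mull; rewrite -(@dvdn_addr (a * (x ^ 2 + b * c * w ^ 2))) ?dvdn_mulr //.
    have := dvdn_trans (dvdn_mulr p (dvdnn p)) dv.
    by congr (_ %| _)%N; rewrite /quad; ring.
  move=> /(qnr_sqr_add p_pr p_odd nr) /andP[+ ->]; rewrite Euclid_dvdM //.
  by rewrite (negPf (co _ ab)).
have /andP[px pw] : (p %| x)%N && (p %| w)%N.
  apply: (qnr_sqr_add p_pr p_odd nr); case/dvdnP: pa => a' aE.
  have pa' : ~~ (p %| a')%N.
    apply/negP => /dvdnP[e a'E]; have := sa p; rewrite aE a'E -mulnA mulnn dvdn_mull //.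
    by move=> /(_ isT) p1; rewrite p1 in p_pr.
  have : (p * p %| p * (a' * (x ^ 2 + b * c * w ^ 2)))%N.
    rewrite -(@dvdn_addl (b * y ^ 2 + c * z ^ 2)).
      by move: dv; congr (_ %| _)%N; rewrite /quad aE; ring.
    by rewrite dvdn_add // dvdn_mull // -mulnn dvdn_mul.
  by rewrite dvdn_pmul2l // Euclid_dvdM // (negPf pa').
by have := prim p p_pr; rewrite px py pz pw.
Qed.

(** * The obstruction at 2, by residues modulo 8 *)

Lemma eqmodD m x x' y y' :
  x = x' %[mod m] -> y = y' %[mod m] -> x + y = x' + y' %[mod m].
Proof. by move=> ex ey; rewrite -modnDm ex ey modnDm. Qed.

Lemma eqmodM m x x' y y' :
  x = x' %[mod m] -> y = y' %[mod m] -> x * y = x' * y' %[mod m].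
Proof. by move=> ex ey; rewrite -modnMm ex ey modnMm. Qed.

Lemma odd_modn m n : ~~ odd m -> odd (n %% m) = odd n.
Proof. by move=> om; rewrite [in RHS](divn_eq n m) oddD oddM (negPf om) andbF. Qed.

Lemma sqr_mod8 x : (x ^ 2 %% 8 \in [:: 0; 1; 4])%N.
Proof.
rewrite -modnXm; have := ltn_pmod x (isT : 0 < 8)%N; move: (x %% 8)%N => r.
by do 8!case: r => [|r] //.
Qed.

Lemma eps_mod8 n : eps (n %% 8)%N = eps n. Proof. by rewrite /eps; lia. Qed.

Lemma tau_mod8 n : tau (n %% 8)%N = tau n. Proof. by rewrite /tau modn_mod. Qed.

(* The exponent of [(-bc/a) (-ac/b) (-ab/c)] for odd [a], [b], [c], and below the
   one of [(-bc/a) (-2ac/b) (-2ab/c)]. *)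
Definition jac_product_odd (a b c : nat) : bool :=
  eps a (+) eps b (+) eps c (+) (eps a && eps b) (+) (eps a && eps c) (+) (eps b && eps c).

Definition jac_product_even (a b c : nat) : bool :=
  jac_product_odd a b c (+) tau b (+) tau c.

(** Turns a claim about three odd numbers and four squares into a finite check, since squares are 0,
    1 or 4 modulo 8. *)
Lemma residues8 (P : nat -> nat -> nat -> nat -> nat -> nat -> nat -> bool) :
    all (fun a => all (fun b => all (fun c => all (fun s => all (fun t => all (fun u =>
      all (P a b c s t u) [:: 0; 1; 4]) [:: 0; 1; 4]) [:: 0; 1; 4]) [:: 0; 1; 4])
      [:: 1; 3; 5; 7]) [:: 1; 3; 5; 7]) [:: 1; 3; 5; 7]%N ->
    forall a b c x y z w : nat, odd a -> odd b -> odd c ->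
  (P (a %% 8) (b %% 8) (c %% 8) (x ^ 2 %% 8) (y ^ 2 %% 8) (z ^ 2 %% 8) (w ^ 2 %% 8))%N.
Proof.
have odd_mod8 n : odd n -> (n %% 8)%N \in [:: 1; 3; 5; 7]%N by rewrite !inE; lia.
move=> chk a b c x y z w /odd_mod8 ao /odd_mod8 bo /odd_mod8 co.
move: chk => /allP/(_ _ ao)/allP/(_ _ bo)/allP/(_ _ co)/allP/(_ _ (sqr_mod8 x)).
by move=> /allP/(_ _ (sqr_mod8 y))/allP/(_ _ (sqr_mod8 z))/allP/(_ _ (sqr_mod8 w)).
Qed.

(** The hypothesis on [jac_product_odd] says that [a], [b], [c] agree modulo 4, as then does [abc].
    Divisibility by 4 makes the variables all even or all odd; the latter fails since
    [a + b + c + abc] is 4 modulo 8. The proof enumerates residues. *)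
Lemma quad_even_of_odd a b c x y z w :
    odd a -> odd b -> odd c -> ~~ jac_product_odd a b c ->
    (8 %| quad a b c (x ^ 2) (y ^ 2) (z ^ 2) (w ^ 2))%N ->
  ~~ [|| odd x, odd y, odd z | odd w].
Proof.
move=> ao bo co j q.
have := @residues8 (fun a b c s t u w => if jac_product_odd a b c then true else
  if (8 %| quad a b c s t u w)%N then ~~ [|| odd s, odd t, odd u | odd w] else true).
move=> /(_ ltac:(by vm_compute) a b c x y z w ao bo co); rewrite !odd_modn // !oddX /=.
rewrite /jac_product_odd !eps_mod8 -/(jac_product_odd a b c) (negPf j).
rewrite /dvdn (_ : quad _ _ _ _ _ _ _ = quad a b c (x ^ 2) (y ^ 2) (z ^ 2) (w ^ 2) %[mod 8]).
  by rewrite -/(dvdn _ _) q.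
by rewrite /quad; do ![exact: modn_mod | apply: eqmodD | apply: eqmodM].
Qed.

Lemma quad_even_of_even a b c x y z w :
    odd a -> odd b -> odd c -> ~~ jac_product_even a b c ->
    (16 %| quad (2 * a) b c (x ^ 2) (y ^ 2) (z ^ 2) (w ^ 2))%N ->
  ~~ [|| odd x, odd y, odd z | odd w].
Proof.
move=> ao bo co j q.
have /norP[yo zo] : ~~ (odd y || odd z).
  have := @residues8 (fun a b c s t u w => if jac_product_even a b c then true else
    if (8 %| quad (2 * a) b c s t u w)%N then ~~ (odd t || odd u) else true).
  move=> /(_ ltac:(by vm_compute) a b c x y z w ao bo co); rewrite !odd_modn // !oddX /=.
  rewrite /jac_product_even /jac_product_odd !eps_mod8 !tau_mod8.
  rewrite -/(jac_product_odd a b c) -/(jac_product_even a b c) (negPf j).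
  rewrite /dvdn (_ : quad _ _ _ _ _ _ _
      = quad (2 * a) b c (x ^ 2) (y ^ 2) (z ^ 2) (w ^ 2) %[mod 8]).
    by rewrite -/(dvdn _ _) (dvdn_trans _ q) //.
  by rewrite /quad; do ![exact: modn_mod | apply: eqmodD | apply: eqmodM | exact: erefl].
rewrite (negPf yo) (negPf zo) /=.
(* With [y] and [z] even, the form is twice another one, which 8 divides because the modulus was 16.
   A second check modulo 8 then handles [x] and [w]. *)
have [yE zE] : y = (2 * y./2)%N /\ z = (2 * z./2)%N by lia.
move: q; rewrite yE zE; move: y./2 z./2 => {yo zo yE zE} y' z' q.
have {}q : (8 %| a * x ^ 2 + 2 * b * y' ^ 2 + 2 * c * z' ^ 2 + a * b * c * w ^ 2)%N.
  by rewrite -(@dvdn_pmul2l 2) //; move: q; congr (_ %| _)%N; rewrite /quad; ring.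
have := @residues8 (fun a b c s t u w => if jac_product_even a b c then true else
  if (8 %| a * s + 2 * b * t + 2 * c * u + a * b * c * w)%N then ~~ (odd s || odd w)
  else true).
move=> /(_ ltac:(by vm_compute) a b c x y' z' w ao bo co); rewrite !odd_modn // !oddX /=.
rewrite /jac_product_even /jac_product_odd !eps_mod8 !tau_mod8.
rewrite -/(jac_product_odd a b c) -/(jac_product_even a b c) (negPf j).
rewrite /dvdn (_ : (_ + _ + _ + _)%N
    = a * x ^ 2 + 2 * b * y' ^ 2 + 2 * c * z' ^ 2 + a * b * c * w ^ 2 %[mod 8]).
  by rewrite -/(dvdn _ _) q.
by do ![exact: modn_mod | apply: eqmodD | apply: eqmodM | exact: erefl].
Qed.

(** * Combining the local obstructions through reciprocity *)

Lemma jac_obstruction n a b c x y z w :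
    odd n -> (n %| a)%N -> squarefree a -> coprime a b -> coprime a c ->
    jac n (- (b * c)%N%:Z) -> primitive x y z w ->
  ~~ (a ^ 2 %| quad a b c (x ^ 2) (y ^ 2) (z ^ 2) (w ^ 2))%N.
Proof.
move=> n_odd na sa ab ac /jac_exists[p pn nr] prim.
have [p_pr p_odd] := odd_primes n_odd pn.
have pa : (p %| a)%N by move: pn; rewrite mem_primes => /and3P[_ _ /dvdn_trans->].
apply: contraNN (local_obstruction p_pr p_odd sa pa ab ac nr prim).
by apply: dvdn_trans; rewrite dvdn_exp2r.
Qed.

Lemma jacNM n b c : (0 < n)%N -> squarefree n -> odd n -> coprime n b -> coprime n c ->
  jac n (- (b * c)%N%:Z) = eps n (+) (jac n b%:Z (+) jac n c%:Z).
Proof.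
move=> n0 sn n_odd nb nc.
rewrite PoszM -mulN1r jacM ?coprimen1 //; last by rewrite abszM coprimeMr nb nc.
by rewrite jacM // jacN1.
Qed.

Lemma squarefree_dvd m n : squarefree n -> (m %| n)%N -> squarefree m.
Proof. by move=> sn mn d /dvdn_trans/(_ mn); apply: sn. Qed.

Lemma squarefree_odd_half n : squarefree n -> ~~ odd n -> odd n./2.
Proof.
move=> sn ne; apply/negPn/negP => n2e; have := sn 2%N.
have -> : n = (2 ^ 2 * n./2./2)%N by lia.
by rewrite dvdn_mulr // => /(_ isT).
Qed.

(** This and the next three lemmas permute coefficients and variables, because [jac_obstruction]
    looks at the first coefficient only. *)
Lemma quadCA a b c s t u w : quad b a c t s u w = quad a b c s t u w.
Proof. by rewrite /quad; ring. Qed.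

Lemma quadAC a b c s t u w : quad a c b s u t w = quad a b c s t u w.
Proof. by rewrite /quad; ring. Qed.

Lemma primitiveCA x y z w : primitive x y z w -> primitive y x z w.
Proof. by move=> prim p /prim; rewrite andbCA. Qed.

Lemma primitiveAC x y z w : primitive x y z w -> primitive x z y w.
Proof. by move=> prim p /prim; do 4!case: (p %| _)%N. Qed.

Section PairwiseCoprime.
Variables a b c : nat.
Hypotheses (a_gt0 : (0 < a)%N) (b_gt0 : (0 < b)%N) (c_gt0 : (0 < c)%N).
Hypotheses (sqf_a : squarefree a) (sqf_b : squarefree b) (sqf_c : squarefree c).
Hypotheses (co_ab : coprime a b) (co_ac : coprime a c) (co_bc : coprime b c).

(** Each symbol contributes one [eps] from its factor -1, and each pair of opposite symbols
    contributes a product of two [eps] by reciprocity. *)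
Lemma jac_product_oddE : odd a -> odd b -> odd c ->
  jac_product_odd a b c = jac a (- (b * c)%N%:Z)
    (+) (jac b (- (a * c)%N%:Z) (+) jac c (- (b * a)%N%:Z)).
Proof.
move=> ao bo co; rewrite !jacNM // 1?coprime_sym //.
rewrite /jac_product_odd -!jac_reciprocity //.
by do 3!case: (eps _); do 6!case: (jac _ _).
Qed.

(** Here [2 * a] is the even coefficient. Its factor 2 enters only the symbols over [b] and [c],
    whence [tau b] and [tau c]. *)
Lemma jac_product_evenE : odd a -> odd b -> odd c ->
  jac_product_even a b c = jac a (- (b * c)%N%:Z)
    (+) (jac b (- (2 * a * c)%N%:Z) (+) jac c (- (b * (2 * a))%N%:Z)).
Proof.
move=> ao bo co; have co2 n : odd n -> coprime n 2 by rewrite coprimen2.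
have [co_ba co_ca co_cb] : [/\ coprime b a, coprime c a & coprime c b].
  by rewrite ![coprime _ a]coprime_sym [coprime c b]coprime_sym.
rewrite !jacNM ?coprimeMr ?co2 ?co_ba ?co_ca // PoszM !jacM ?co2 // !jac2 //.
rewrite /jac_product_even /jac_product_odd -!jac_reciprocity //.
by do 3!case: (eps _); do 2!case: (tau _); do 6!case: (jac _ _).
Qed.

End PairwiseCoprime.

(** A true sum of three exponents has a true term, and [jac_obstruction] applies to the matching
    coefficient. The divisor [a'] allows for [a] even, where its odd half is taken. *)
Lemma quad_obstruction a' a b c x y z w :
    odd a' -> (a' %| a)%N -> odd b -> odd c ->
    squarefree a -> squarefree b -> squarefree c ->
    coprime a b -> coprime a c -> coprime b c ->
    primitive x y z w ->
    jac a' (- (b * c)%N%:Z) (+) (jac b (- (a * c)%N%:Z) (+) jac c (- (b * a)%N%:Z)) ->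
  ~~ ((a * b * c) ^ 2 %| quad a b c (x ^ 2) (y ^ 2) (z ^ 2) (w ^ 2))%N.
Proof.
move=> a'o a'a bo co sa sb sc ab ac bc prim js; apply/negP => dv.
have abc_dvd n : (n %| a * b * c)%N ->
    (n ^ 2 %| quad a b c (x ^ 2) (y ^ 2) (z ^ 2) (w ^ 2))%N.
  by move=> nd; apply: dvdn_trans dv; rewrite dvdn_exp2r.
have [ja|ja] := boolP (jac a' (- (b * c)%N%:Z)).
  have /negP[] := jac_obstruction a'o a'a sa ab ac ja prim.
  by rewrite abc_dvd // -mulnA dvdn_mulr.
have [jb|jb] := boolP (jac b (- (a * c)%N%:Z)).
  rewrite coprime_sym in ab.
  have /negP[] := jac_obstruction bo (dvdnn b) sb ab bc jb (primitiveCA prim).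
  by rewrite quadCA abc_dvd // dvdn_mulr // dvdn_mull.
move: js; rewrite (negPf ja) (negPf jb) => jc; rewrite coprime_sym in ac.
rewrite coprime_sym in bc.
(* Reversing the first three variables brings [c] to the front. *)
have /negP[] := jac_obstruction co (dvdnn c) sc bc ac jc
  (primitiveCA (primitiveAC (primitiveCA prim))).
by rewrite quadCA quadAC quadCA abc_dvd // dvdn_mull.
Qed.

(** * The two cases of the theorem *)

Lemma not_represented_odd a b c (N : int) :
    (0 < a)%N -> (0 < b)%N -> (0 < c)%N ->
    squarefree a -> squarefree b -> squarefree c ->
    coprime a b -> coprime a c -> coprime b c ->
    odd a -> odd b -> odd c ->
    (N = - (a * b * c)%N%:Z %[mod (8 * (a * b * c) ^ 2)%N%:Z])%Z ->
  ~ represented_over_rat a b c N.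
Proof.
move=> a0 b0 c0 sa sb sc ab ac bc ao bo co cN.
move=> /(represented_primitive cN)[x [y [z [w [prim dv]]]]].
have [j|j] := boolP (jac_product_odd a b c).
  rewrite jac_product_oddE // in j.
  have /negP[] := quad_obstruction ao (dvdnn a) bo co sa sb sc ab ac bc prim j.
  by apply: dvdn_trans dv; rewrite dvdn_mull.
have := quad_even_of_odd ao bo co j (dvdn_trans (dvdn_mulr _ (dvdnn 8)) dv).
by have := prim 2 isT; rewrite !dvdn2 !negb_or => /negP.
Qed.

Lemma not_represented_even a b c (N : int) :
    (0 < a)%N -> (0 < b)%N -> (0 < c)%N ->
    squarefree a -> squarefree b -> squarefree c ->
    coprime a b -> coprime a c -> coprime b c -> ~~ odd a ->
    (N = - (a * b * c)%N%:Z %[mod ((2 * (a * b * c)) ^ 2)%N%:Z])%Z ->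
  ~ represented_over_rat a b c N.
Proof.
move=> a0 b0 c0 sa sb sc ab ac bc ae cN.
move=> /(represented_primitive cN)[x [y [z [w [prim dv]]]]].
have aE : a = (2 * a./2)%N by rewrite mul2n even_halfK.
have a'a : (a./2 %| a)%N by rewrite {2}aE dvdn_mull.
have sa' := squarefree_dvd sa a'a.
have odd_co n : coprime a n -> odd n.
  by rewrite aE coprimeMl coprime2n => /andP[].
have [bo co] := (odd_co b ab, odd_co c ac).
have a'o := squarefree_odd_half sa ae.
have a'0 : (0 < a./2)%N by rewrite odd_gt0.
have [j|j] := boolP (jac_product_even a./2 b c).
  rewrite jac_product_evenE ?(coprime_dvdl a'a) // -aE in j.
  have /negP[] := quad_obstruction a'o a'a bo co sa sb sc ab ac bc prim j.
  by apply: dvdn_trans dv; rewrite dvdn_exp2r // dvdn_mull.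
(* Since [a] is even, [2abc] is a multiple of 4. *)
have dv16 : (16 %| (2 * (a * b * c)) ^ 2)%N.
  by rewrite (@dvdn_exp2r 4 _ 2) // aE -!mulnA mulnA dvdn_mulr.
have := dvdn_trans dv16 dv; rewrite {1}aE => /(quad_even_of_even a'o bo co j).
by have := prim 2 isT; rewrite !dvdn2 !negb_or => /negP.
Qed.

Theorem corollary2 (a b c : nat)
    (a_gt0 : (0 < a)%N) (b_gt0 : (0 < b)%N) (c_gt0 : (0 < c)%N)
    (sqf_a : squarefree a) (sqf_b : squarefree b) (sqf_c : squarefree c)
    (co_ab : coprime a b) (co_ac : coprime a c) (co_bc : coprime b c) :
  (odd a /\ odd b /\ odd c ->
     forall N : int,
       (N = - (a * b * c)%N%:Z %[mod (8 * (a * b * c) ^ 2)%N%:Z])%Z ->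
       ~ represented_over_rat a b c N) /\
  (~~ odd a \/ ~~ odd b \/ ~~ odd c ->
     forall N : int,
       (N = - (a * b * c)%N%:Z %[mod ((2 * (a * b * c)) ^ 2)%N%:Z])%Z ->
       ~ represented_over_rat a b c N).
Proof.
split=> [[ao [bo co]] N | even N]; first exact: not_represented_odd.
(* By symmetry the even coefficient can be moved to the first place. *)
case: even => [ae|[be|ce]]; first exact: not_represented_even.
  move=> cN [x [y [z E]]]; apply: (@not_represented_even b a c N) => //.
  - by rewrite coprime_sym.
  - by rewrite [(b * a)%N]mulnC.
  - by exists y, x, z; rewrite -E; congr (_ + _); rewrite addrC.
move=> cN [x [y [z E]]]; apply: (@not_represented_even c a b N) => //.
- by rewrite coprime_sym.
- by rewrite coprime_sym.
- by rewrite -mulnA [(c * _)%N]mulnC.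
- by exists z, x, y; rewrite -E [RHS]addrC addrA.
Qed.
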